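(* For every graph $H$, there is a locally bijective homomorphism from $L^*(H)$ to the line graph $L(H)$. (Hence $L^*(H)$ is a 2-lift of $L(H)$.)
   Context: All graphs are finite and simple. For a graph $H$, let $\vec{D}(H)$ be the directed graph obtained by replacing each edge $uv$ of $H$ by the two arcs $(u,v)$ and $(v,u)$. The oriented line graph $\vec{L}(H)$ is the oriented graph whose vertex set is the set of arcs of $\vec{D}(H)$ (i.e. $\bigcup_{uv\in E(H)}\{(u,v),(v,u)\}$), with an arc from $(u,v)$ to $(v,w)$ whenever $u\neq w$. $L^*(H)$ denotes the underlying undirected graph of $\vec{L}(H)$. The line graph $L(H)$ has vertex set $E(H)$, two vertices adjacent iff the edges share an endpoint. A locally bijective homomorphism (LBH) from a graph $G$ to a graph $H$ is a map $\psi\colon V(G)\to V(H)$ such that for every $v\in V(G)$ the restriction of $\psi$ to the neighbourhood $N_G(v)$ is a bijection from $N_G(v)$ onto $N_H(\psi(v))$. *)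

(* Defs.v *)
From HB Require Import structures.
From mathcomp Require Import all_boot.

Set Implicit Arguments.
Unset Strict Implicit.
Unset Printing Implicit Defensive.

Record sgraph := SGraph {
  svertex :> finType;
  adj : rel svertex;
  adj_sym : symmetric adj;
  adj_irrefl : irreflexive adj }.

Record digraph := DiGraph {
  dvertex :> finType;
  darc : rel dvertex }.

Definition nbh (G : sgraph) (v : G) : {set G} := [set w | adj v w].

(* The image equality says both that [psi] maps the neighbourhood of [v] into
   that of [psi v] and that it does so surjectively. *)
Definition lbh (G H : sgraph) (psi : G -> H) : Prop :=
  forall v : G, {in nbh v &, injective psi} /\ psi @: nbh v = nbh (psi v).

(* A k-lift is a k-fold cover: all fibres have exactly k elements, also when
   the base graph is disconnected. *)
Definition is_lift (k : nat) (G H : sgraph) : Prop :=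
  exists psi : G -> H, lbh psi /\ forall y : H, #|[set x | psi x == y]| = k.

Section Underlying.
Variable D : digraph.

Definition underlying_adj : rel D :=
  fun x y => (x != y) && (darc x y || darc y x).

Lemma underlying_sym : symmetric underlying_adj.
Proof. by move=> x y; rewrite /underlying_adj eq_sym orbC. Qed.

Lemma underlying_irrefl : irreflexive underlying_adj.
Proof. by move=> x; rewrite /underlying_adj eqxx. Qed.

Definition underlying : sgraph := SGraph underlying_sym underlying_irrefl.
End Underlying.

(* Replacing each edge by two opposite arcs leaves the relation unchanged. *)
Definition bidirected (H : sgraph) : digraph := DiGraph (@adj H).

Definition arc_of (D : digraph) : finType := {p : D * D | darc p.1 p.2}.

Definition oriented_line_graph (H : sgraph) : digraph :=
  @DiGraph (arc_of (bidirected H))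
    (fun a b => ((val a).2 == (val b).1) && ((val a).1 != (val b).2)).

Definition Lstar (H : sgraph) : sgraph := underlying (oriented_line_graph H).

Section LineGraph.
Variable H : sgraph.

Definition edge_set : {set {set H}} :=
  [set [set p.1; p.2] | p : H * H & adj p.1 p.2].

Definition edge_of : finType := {e : {set H} | e \in edge_set}.

Definition line_adj : rel edge_of :=
  fun e f => (e != f) && (val e :&: val f != set0).

Lemma line_adj_sym : symmetric line_adj.
Proof. by move=> e f; rewrite /line_adj eq_sym setIC. Qed.

Lemma line_adj_irrefl : irreflexive line_adj.
Proof. by move=> e; rewrite /line_adj eqxx. Qed.

Definition line_graph : sgraph := SGraph line_adj_sym line_adj_irrefl.
End LineGraph.

(* Main.v *)
(* Send an arc to its underlying edge. The two arcs over an edge are reverses of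
   each other, and an arc is never adjacent in L* both to an arc and to its
   reverse, so the map is injective on neighbourhoods. An edge f meeting {u, v}
   in v is hit by its orientation leaving v; one meeting it in u is hit by its
   orientation entering u. *)
Require Import Defs.
From mathcomp Require Import all_boot.

Set Implicit Arguments.
Unset Strict Implicit.
Unset Printing Implicit Defensive.

Lemma set2_eq (T : finType) (a b c d : T) :
  [set a; b] = [set c; d] -> (a = c /\ b = d) \/ (a = d /\ b = c).
Proof.
move=> E.
have := set21 a b; rewrite E !inE => ha.
have := set22 a b; rewrite E !inE => hb.
have := set21 c d; rewrite -E !inE => hc.
have := set22 c d; rewrite -E !inE => hd.
case/orP: ha => /eqP ?; subst.
  (* If [d] falls on the element already matched, the right-hand set is a singleton and only [hb]
     pins down [b]. *)
  by case/orP: hd => /eqP ?; subst; [case/orP: hb => /eqP ?; subst|]; left.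
by case/orP: hc => /eqP ?; subst; [case/orP: hb => /eqP ?; subst|]; right.
Qed.

Section ArcEdge.
Variable H : sgraph.
Implicit Types (a b : Lstar H) (f : line_graph H).

Lemma arc_eq a b : (val a).1 = (val b).1 -> (val a).2 = (val b).2 -> a = b.
Proof.
by case: a b => [[u v] uv] [[x y] xy] /= e1 e2; apply: val_inj; congr pair.
Qed.

Lemma arc_adj a : adj (val a).1 (val a).2.
Proof. exact: (valP a). Qed.

Lemma arc_ends_neq a : (val a).1 != (val a).2.
Proof. by apply/eqP => E; have := arc_adj a; rewrite E adj_irrefl. Qed.

Lemma arc_edge_subproof a : [set (val a).1; (val a).2] \in edge_set H.
Proof. by apply/imsetP; exists (val a); rewrite // inE arc_adj. Qed.

Definition arc_edge a : line_graph H :=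
  exist (fun e => e \in edge_set H) _ (arc_edge_subproof a).

Lemma rev_arc_subproof a : adj (val a).2 (val a).1.
Proof. by rewrite adj_sym arc_adj. Qed.

Definition rev_arc a : Lstar H :=
  exist (fun p : H * H => adj p.1 p.2) ((val a).2, (val a).1)
    (rev_arc_subproof a).

Lemma rev_arc_neq a : rev_arc a != a.
Proof.
by apply: contraNneq (arc_ends_neq a) => /(congr1 (fst \o val)) /= ->.
Qed.

Lemma arc_edge_rev a : arc_edge (rev_arc a) = arc_edge a.
Proof. by apply: val_inj; rewrite /= setUC. Qed.

(** Equal two-element sets have the same ends up to a swap. This describes the fibres, and serves
    for injectivity, distinctness of image edges and the fibre count. *)
Lemma arc_edge_eqP a b :
  reflect (b = a \/ b = rev_arc a) (arc_edge b == arc_edge a).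
Proof.
apply: (iffP eqP) => [/(congr1 val) /set2_eq|[]->]; rewrite ?arc_edge_rev //.
by case=> [] [b1 b2]; [left|right]; apply: arc_eq.
Qed.

Lemma arc_edge_onto f : exists a, arc_edge a = f.
Proof.
case: f => e ef; have /imsetP[p] := ef; rewrite inE => pA eE.
by exists (exist (fun p : H * H => adj p.1 p.2) p pA); apply: val_inj.
Qed.

Lemma edge_arc_from f x : x \in val f -> exists2 a, arc_edge a = f & (val a).1 = x.
Proof.
have [a <-] := arc_edge_onto f; rewrite !inE => /orP[] /eqP ->; first by exists a.
by exists (rev_arc a); rewrite ?arc_edge_rev.
Qed.

Lemma edge_arc_to f x : x \in val f -> exists2 a, arc_edge a = f & (val a).2 = x.
Proof.
by case/edge_arc_from=> a <- <-; exists (rev_arc a); rewrite ?arc_edge_rev.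
Qed.

Lemma Lstar_adj a b : adj a b =
  ((val a).2 == (val b).1) && ((val a).1 != (val b).2)
  || ((val b).2 == (val a).1) && ((val b).1 != (val a).2).
Proof.
(* The oriented line graph has no loops: an arc following itself would have equal ends. *)
rewrite /= /underlying_adj /= andb_idl // => ab; apply/eqP => E; subst b.
by move: ab; rewrite eq_sym (negbTE (arc_ends_neq a)).
Qed.

(** Say [a] ends where [b] starts. If [rev_arc b] followed [a], then [b] would be a loop; if it
    preceded [a], then [a] would be one. The other case is symmetric. *)
Lemma Lstar_adj_rev a b : adj a b -> ~~ adj a (rev_arc b).
Proof.
have := arc_ends_neq b; have := arc_ends_neq a; rewrite !Lstar_adj /=.
move=> /negbTE a12 /negbTE b12 /orP[] /andP[/eqP e _].
  by rewrite e b12 -e [_ == (val a).1]eq_sym a12.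
by rewrite e [_ == (val a).1]eq_sym a12 -e b12.
Qed.

Lemma arc_edge_adj a b : adj a b -> adj (arc_edge a) (arc_edge b).
Proof.
move=> ab; rewrite /= /line_adj eq_sym; apply/andP; split.
  apply/negP => /arc_edge_eqP[] E; subst b; first by rewrite adj_irrefl in ab.
  (* The condition against backtracking in the oriented line graph rules out [rev_arc a] as a
     neighbour of [a]. *)
  by move: ab; rewrite Lstar_adj /= !eqxx andbF.
move: ab; rewrite Lstar_adj; case/orP=> /andP[/eqP e _]; apply/set0Pn.
  by exists (val a).2; rewrite !inE -e eqxx orbT.
by exists (val a).1; rewrite !inE e !eqxx orbT.
Qed.

Lemma arc_edge_lbh : lbh arc_edge.
Proof.
move=> a; split.
  move=> b c; rewrite !inE => ab ac /eqP /arc_edge_eqP[] // E; subst b.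
  by have := Lstar_adj_rev ac; rewrite ab.
apply/setP=> f; apply/imsetP/idP.
  by case=> b; rewrite !inE => ab ->; exact: arc_edge_adj.
rewrite inE => /andP[nf /set0Pn[x /setIP[]]]; rewrite !inE => /orP[] /eqP-> xf.
  have [b bf b2] := edge_arc_to xf; exists b; rewrite // inE Lstar_adj b2 eqxx /=.
  (* Backtracking would force [b] to be [rev_arc a], so [f] would be the edge of [a] itself, against
     [nf]. *)
  apply/orP; right; apply: contraNneq nf => b1; rewrite -bf eq_sym.
  by apply/arc_edge_eqP; right; apply: arc_eq.
have [b bf b1] := edge_arc_from xf; exists b; rewrite // inE Lstar_adj b1 eqxx /=.
apply/orP; left; apply: contraNneq nf => b2; rewrite -bf eq_sym.
by apply/arc_edge_eqP; right; apply: arc_eq.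
Qed.

(** The fibre consists of an orientation of [f] and its reverse, which differ because [H] has no
    loops. *)
Lemma card_arc_edge_fibre f : #|[set a | arc_edge a == f]| = 2.
Proof.
have [a <-] := arc_edge_onto f.
have -> : [set b | arc_edge b == arc_edge a] = [set a; rev_arc a].
  apply/setP=> b; rewrite !inE.
  by apply/arc_edge_eqP/orP => [[]->|[]/eqP]; rewrite ?eqxx ?orbT; auto.
by rewrite cards2 eq_sym rev_arc_neq.
Qed.

End ArcEdge.

Theorem theorem1 (H : sgraph) :
  (exists psi : Lstar H -> line_graph H, lbh psi) /\
  is_lift 2 (Lstar H) (line_graph H).
Proof.
split; exists (@arc_edge H); first exact: arc_edge_lbh.
by split; [exact: arc_edge_lbh | exact: card_arc_edge_fibre].
Qed.
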